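(* For every Hausdorff space $(X,\tau)$ with $X$ infinite, it holds true in $\mathbf{ZF}$ that $(X,\tau)$ is a $k$-space if and only if every subset of $X$ that is compact in $(X,\tau^{\star})$ is closed in $(X,\tau)$, where $\tau^{\star}$ is the compact complement topology of $(X,\tau)$.
   Context: $\mathbf{ZF}$ is Zermelo–Fraenkel set theory without the axiom of choice. For a Hausdorff space $(X,\tau)$ with $X$ infinite, the compact complement topology of $(X,\tau)$ is $\tau^{\star}=\{\emptyset\}\cup\{X\setminus M : M \text{ is compact in } (X,\tau)\}$, which is a topology on $X$. Compact means that every open cover has a finite subcover (no separation axiom is included). A Hausdorff space $Z$ is called a $k$-space if, for every $A\subseteq Z$, $A$ is closed in $Z$ if and only if $A\cap K$ is closed in $Z$ for each compact set $K$ in $Z$. *)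

(* Defs.v *)
(** "It holds true in ZF that ..." is rendered as "... holds in every model of
    ZF", which by Gödel's completeness theorem is the same as provability from
    the first-order axioms of ZF.  Every topological notion below is therefore
    a first-order formula evaluated inside an arbitrary structure [M] for the
    language of set theory; spaces, topologies, covers, functions and natural
    numbers are elements of [M].  Since [M] need not satisfy the axiom of
    choice, choice principles of the metatheory give no choice inside [M]. *)

From Stdlib Require Import Setoid.

Set Implicit Arguments.
Unset Strict Implicit.

Record set_structure : Type := SetStructure {
  carrier :> Type;
  mem : carrier -> carrier -> Prop
}.

Declare Scope zf_scope.
Delimit Scope zf_scope with zf.
Notation "x ∈ y" := (mem x y) (at level 70, no associativity) : zf_scope.
Notation "x ∉ y" := (~ mem x y) (at level 70, no associativity) : zf_scope.
Notation "A ⊆ B" := (forall z, mem z A -> mem z B)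
  (at level 70, no associativity) : zf_scope.
Local Open Scope zf_scope.

(** First-order formulas of set theory, with de Bruijn indices: they are only
    needed for the schemas of separation and replacement. *)
Inductive formula : Type :=
| FMem (i j : nat)
| FEq (i j : nat)
| FBot
| FAnd (p q : formula)
| FOr (p q : formula)
| FImp (p q : formula)
| FAll (p : formula)
| FEx (p : formula).

Definition scons (M : Type) (x : M) (rho : nat -> M) (n : nat) : M :=
  match n with 0 => x | S k => rho k end.

Fixpoint sat (M : set_structure) (rho : nat -> M) (p : formula) : Prop :=
  match p with
  | FMem i j => rho i ∈ rho j
  | FEq i j => rho i = rho j
  | FBot => False
  | FAnd p q => sat rho p /\ sat rho q
  | FOr p q => sat rho p \/ sat rho q
  | FImp p q => sat rho p -> sat rho q
  | FAll p => forall x : M, sat (scons x rho) p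
  | FEx p => exists x : M, sat (scons x rho) p
  end.

(** [s = {x | P x}], for a class [P]. *)
Definition extension (M : set_structure) (s : M) (P : M -> Prop) : Prop :=
  forall x, x ∈ s <-> P x.

(** [{x | P x} ∈ t]. *)
Definition class_mem (M : set_structure) (P : M -> Prop) (t : M) : Prop :=
  exists s, extension s P /\ s ∈ t.

Definition is_successor (M : set_structure) (n s : M) : Prop :=
  extension s (fun x => x ∈ n \/ x = n).

Definition inductive_set (M : set_structure) (I : M) : Prop :=
  class_mem (fun _ => False) I /\
  (forall n, n ∈ I -> exists s, is_successor n s /\ s ∈ I).

Record ZF_model (M : set_structure) : Prop := {
  ZF_extensionality : forall A B : M, (forall x, x ∈ A <-> x ∈ B) -> A = B;
  ZF_foundation : forall A : M, (exists x, x ∈ A) ->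
    exists x, x ∈ A /\ forall y, y ∈ x -> y ∉ A;
  ZF_pairing : forall a b : M, exists P, extension P (fun x => x = a \/ x = b);
  ZF_union : forall A : M,
    exists U, extension U (fun x => exists y, y ∈ A /\ x ∈ y);
  ZF_powerset : forall A : M, exists P, extension P (fun x => x ⊆ A);
  ZF_infinity : exists I : M, inductive_set I;
  (* the values of [rho] are the parameters of the schemas *)
  ZF_separation : forall (p : formula) (rho : nat -> M) (A : M),
    exists B, extension B (fun x => x ∈ A /\ sat (scons x rho) p);
  ZF_replacement : forall (p : formula) (rho : nat -> M) (A : M),
    (forall x y z, x ∈ A -> sat (scons y (scons x rho)) p ->
       sat (scons z (scons x rho)) p -> y = z) ->
    exists B, extension B
      (fun y => exists x, x ∈ A /\ sat (scons y (scons x rho)) p)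
}.

Definition is_pair (M : set_structure) (a b p : M) : Prop :=
  extension p (fun x => x = a \/ x = b).

(** Kuratowski pairs. *)
Definition is_ordered_pair (M : set_structure) (a b p : M) : Prop :=
  exists s t, is_pair a a s /\ is_pair a b t /\ is_pair s t p.

(** [(a, b) ∈ f]. *)
Definition maps (M : set_structure) (f a b : M) : Prop :=
  exists p, is_ordered_pair a b p /\ p ∈ f.

Definition bijection (M : set_structure) (f A B : M) : Prop :=
  (forall p, p ∈ f -> exists a b, a ∈ A /\ b ∈ B /\ is_ordered_pair a b p) /\
  (forall a, a ∈ A -> exists b, maps f a b) /\
  (forall a b c, maps f a b -> maps f a c -> b = c) /\
  (forall b, b ∈ B -> exists a, maps f a b) /\
  (forall a b c, maps f a c -> maps f b c -> a = b).

Definition natural_number (M : set_structure) (n : M) : Prop :=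
  forall I : M, inductive_set I -> n ∈ I.

Definition finite (M : set_structure) (A : M) : Prop :=
  exists n f, natural_number n /\ bijection f n A.

Definition infinite (M : set_structure) (A : M) : Prop := ~ finite A.

Section Topology.
Context {M : set_structure}.
Implicit Types (X tau A K : M).

Definition topology X tau : Prop :=
  (forall U, U ∈ tau -> U ⊆ X) /\
  class_mem (fun _ => False) tau /\
  X ∈ tau /\
  (forall C, C ⊆ tau -> class_mem (fun x => exists U, U ∈ C /\ x ∈ U) tau) /\
  (forall U W, U ∈ tau -> W ∈ tau -> class_mem (fun x => x ∈ U /\ x ∈ W) tau).

Definition hausdorff_space X tau : Prop :=
  topology X tau /\
  forall x y, x ∈ X -> y ∈ X -> x <> y ->
    exists U W, U ∈ tau /\ W ∈ tau /\ x ∈ U /\ y ∈ W /\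
      forall z, ~ (z ∈ U /\ z ∈ W).

(** [A] is a class, so that it can be applied to a set [{x | x ∈ A}] as well
    as to an intersection [{x | x ∈ A /\ x ∈ K}]. *)
Definition closed X tau (A : M -> Prop) : Prop :=
  (forall x, A x -> x ∈ X) /\ class_mem (fun x => x ∈ X /\ ~ A x) tau.

Definition compact X tau K : Prop :=
  K ⊆ X /\
  forall C, C ⊆ tau -> (forall x, x ∈ K -> exists U, U ∈ C /\ x ∈ U) ->
    exists D, D ⊆ C /\ finite D /\
      forall x, x ∈ K -> exists U, U ∈ D /\ x ∈ U.

Definition k_space X tau : Prop :=
  hausdorff_space X tau /\
  forall A, A ⊆ X ->
    (closed X tau (fun x => x ∈ A) <->
     forall K, compact X tau K -> closed X tau (fun x => x ∈ A /\ x ∈ K)).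

(** [tau_star = {∅} ∪ {X \ K | K is compact in (X, tau)}]. *)
Definition compact_complement_topology X tau tau_star : Prop :=
  extension tau_star (fun U =>
    extension U (fun _ => False) \/
    exists K, compact X tau K /\ extension U (fun x => x ∈ X /\ x ∉ K)).

End Topology.

Definition definable (M : set_structure) (P : (nat -> M) -> Prop) : Prop :=
  exists p, forall rho, sat rho p <-> P rho.

Section Definability.
Context {M : set_structure}.
Implicit Types (P Q : (nat -> M) -> Prop) (S : M -> (nat -> M) -> Prop).

Lemma definable_mem i j : definable (fun rho : nat -> M => rho i ∈ rho j).
Proof. exists (FMem i j); intro rho; exact (iff_refl _). Qed.

Lemma definable_eq i j : definable (fun rho : nat -> M => rho i = rho j).
Proof. exists (FEq i j); intro rho; exact (iff_refl _). Qed.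

Lemma definable_false : definable (fun _ : nat -> M => False).
Proof. exists FBot; intro rho; exact (iff_refl _). Qed.

Lemma definable_and P Q :
  definable P -> definable Q -> definable (fun rho => P rho /\ Q rho).
Proof.
intros [p Hp] [q Hq]; exists (FAnd p q); intro rho; simpl.
rewrite Hp, Hq; exact (iff_refl _).
Qed.

Lemma definable_or P Q :
  definable P -> definable Q -> definable (fun rho => P rho \/ Q rho).
Proof.
intros [p Hp] [q Hq]; exists (FOr p q); intro rho; simpl.
rewrite Hp, Hq; exact (iff_refl _).
Qed.

Lemma definable_imp P Q :
  definable P -> definable Q -> definable (fun rho => P rho -> Q rho).
Proof.
intros [p Hp] [q Hq]; exists (FImp p q); intro rho; simpl.
rewrite Hp, Hq; exact (iff_refl _).
Qed.

Lemma definable_all S :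
  definable (fun rho => S (rho 0) (fun i => rho (Datatypes.S i))) ->
  definable (fun rho => forall x, S x rho).
Proof.
intros [p Hp]; exists (FAll p); intro rho; simpl.
split; intros H x; exact (proj1 (Hp (scons x rho)) (H x))
  || exact (proj2 (Hp (scons x rho)) (H x)).
Qed.

Lemma definable_ex S :
  definable (fun rho => S (rho 0) (fun i => rho (Datatypes.S i))) ->
  definable (fun rho => exists x, S x rho).
Proof.
intros [p Hp]; exists (FEx p); intro rho; simpl.
split; intros [x H]; exists x; exact (proj1 (Hp (scons x rho)) H)
  || exact (proj2 (Hp (scons x rho)) H).
Qed.

End Definability.

Ltac definability :=
  cbv beta delta [compact closed finite natural_number bijection maps
    is_ordered_pair is_pair inductive_set is_successor class_mem extension
    infinite iff not];
  repeat first
    [ apply definable_mem | apply definable_eq | apply definable_false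
    | apply definable_and | apply definable_or
    | refine (@definable_all _ (fun x rho => _) _); cbv beta
    | apply definable_imp
    | refine (@definable_ex _ (fun x rho => _) _); cbv beta ].

Lemma compact_complement_topology_exists (M : set_structure) :
  ZF_model M -> forall X tau : M,
  exists tau_star, compact_complement_topology X tau tau_star.
Proof.
intros HM X tau.
assert (D : definable (fun rho : nat -> M =>
  extension (rho 0) (fun _ => False) \/
  exists K, compact (rho 1) (rho 2) K /\
    extension (rho 0) (fun x => x ∈ rho 1 /\ x ∉ K))) by definability.
destruct D as [p Hp].
destruct (ZF_powerset HM X) as [PX HPX].
destruct (ZF_separation HM p (scons X (fun _ => tau)) PX) as [T HT].
exists T; intro U; split.
- intro HU; apply HT in HU; destruct HU as [_ HU].
  exact (proj1 (Hp _) HU).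
- intro HU; apply HT; split; [apply HPX | exact (proj2 (Hp _) HU)].
  intros z Hz; destruct HU as [HU | [K [_ HU]]]; apply HU in Hz.
  + contradiction.
  + exact (proj1 Hz).
Qed.

Lemma compact_complement_topology_unique (M : set_structure) :
  ZF_model M -> forall X tau t1 t2 : M,
  compact_complement_topology X tau t1 ->
  compact_complement_topology X tau t2 -> t1 = t2.
Proof.
intros HM X tau t1 t2 H1 H2; apply (ZF_extensionality HM); intro U.
exact (iff_trans (H1 U) (iff_sym (H2 U))).
Qed.

(* Main.v *)
(** Let [K] be compact in the Hausdorff space [X].

    If [X] is a k-space and [A] is compact in [tau_star], take [x ∉ A].  For
    [y ∈ A] separate [x] and [y] by disjoint open [V] and [W]; the complement
    of the compact set [K \ W] is [tau_star]-open, contains [y], and meets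
    [V ∩ K] nowhere.  Finitely many such complements cover [A], so some
    neighbourhood of [x] misses [A ∩ K].  Hence every [A ∩ K] is closed.

    Conversely, if every [A ∩ K] is closed, then [A] is compact in
    [tau_star]: one member [X \ K] of an open cover leaves only the compact
    set [A ∩ K] to be covered, and [tau_star ⊆ tau].

    The covers used consist of all open sets that admit a suitable witness,
    and witnesses are merged by induction on finite sets, so that no choice
    is needed. *)

Require Import Defs.
From Stdlib Require Import Classical.

Set Implicit Arguments.
Unset Strict Implicit.

Local Open Scope zf_scope.

(** * Basic sets obtained from the axioms *)

Section SetTheory.
Context {M : set_structure} (HM : ZF_model M).
Implicit Types (A B D X Y a b c d e f n p q x y : M).

Lemma extension_unique A B (P : M -> Prop) :
  extension A P -> extension B P -> A = B.
Proof.
intros HA HB; apply (ZF_extensionality HM); intro x.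
exact (iff_trans (HA x) (iff_sym (HB x))).
Qed.

(** Separation for predicates whose formula code is found by [definability]. In [P] the index 0
    stands for the element being tested, and the parameters in [rho] start at index 1. *)
Lemma definable_separation (P : (nat -> M) -> Prop) (rho : nat -> M) A :
  definable P -> exists B, extension B (fun x => x ∈ A /\ P (scons x rho)).
Proof.
intros [p Hp]; destruct (ZF_separation HM p rho A) as [B HB].
exists B; intro x; rewrite (HB x), Hp; reflexivity.
Qed.

Lemma empty_exists : exists e : M, extension e (fun _ => False).
Proof.
destruct (ZF_infinity HM) as [I [[e [He _]] _]]; exists e; exact He.
Qed.

Lemma insert_exists A a : exists B, extension B (fun x => x ∈ A \/ x = a).
Proof.
destruct (ZF_pairing HM a a) as [s Hs].
destruct (ZF_pairing HM A s) as [t Ht].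
destruct (ZF_union HM t) as [U HU].
exists U; intro x; split.
- intros Hx; apply HU in Hx; destruct Hx as [y [Hy Hx]].
  apply Ht in Hy; destruct Hy as [-> | ->]; [left; exact Hx |].
  apply Hs in Hx; destruct Hx; right; assumption.
- intros [Hx | ->]; apply HU.
  + exists A; split; [apply Ht; left; reflexivity | exact Hx].
  + exists s; split; [apply Ht; right; reflexivity | apply Hs; left; reflexivity].
Qed.

Lemma difference_exists A B : exists D, extension D (fun x => x ∈ A /\ x ∉ B).
Proof.
apply (@definable_separation (fun rho => rho 0 ∉ rho 1) (fun _ => B)).
definability.
Qed.

Lemma intersection_exists A B : exists D, extension D (fun x => x ∈ A /\ x ∈ B).
Proof.
apply (@definable_separation (fun rho => rho 0 ∈ rho 1) (fun _ => B)).
definability.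
Qed.

Lemma remove_exists A a : exists D, extension D (fun x => x ∈ A /\ x <> a).
Proof.
apply (@definable_separation (fun rho => rho 0 <> rho 1) (fun _ => a)).
definability.
Qed.

(** Foundation applied to the singleton of [x]. Hence the successor of [n] really gains a new
    element, as counting by bijections requires. *)
Lemma mem_irrefl x : x ∉ x.
Proof.
intro Hx; destruct (ZF_pairing HM x x) as [s Hs].
destruct (ZF_foundation HM (A := s)) as [y [Hy Hmin]].
- exists x; apply Hs; left; reflexivity.
- assert (y = x) as -> by (apply Hs in Hy; destruct Hy; assumption).
  exact (Hmin x Hx Hy).
Qed.

(** * Ordered pairs and bijections *)

Lemma is_pair_inj a b c d p :
  is_pair a b p -> is_pair c d p -> a = c /\ b = d \/ a = d /\ b = c.
Proof.
intros H1 H2.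
assert (Ha := proj1 (H2 a) (proj2 (H1 a) (or_introl eq_refl))).
assert (Hb := proj1 (H2 b) (proj2 (H1 b) (or_intror eq_refl))).
assert (Hc := proj1 (H1 c) (proj2 (H2 c) (or_introl eq_refl))).
assert (Hd := proj1 (H1 d) (proj2 (H2 d) (or_intror eq_refl))).
simpl in *; intuition congruence.
Qed.

Lemma ordered_pair_exists a b : exists p, is_ordered_pair a b p.
Proof.
destruct (ZF_pairing HM a a) as [s Hs], (ZF_pairing HM a b) as [t Ht].
destruct (ZF_pairing HM s t) as [p Hp].
exists p, s, t; repeat split; (apply Hs || apply Ht || apply Hp).
Qed.

Lemma ordered_pair_unique a b p q :
  is_ordered_pair a b p -> is_ordered_pair a b q -> p = q.
Proof.
intros [s [t [Hs [Ht Hp]]]] [s' [t' [Hs' [Ht' Hq]]]].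
assert (s' = s) as -> by exact (extension_unique Hs' Hs).
assert (t' = t) as -> by exact (extension_unique Ht' Ht).
exact (extension_unique Hp Hq).
Qed.

Lemma ordered_pair_inj a b c d p :
  is_ordered_pair a b p -> is_ordered_pair c d p -> a = c /\ b = d.
Proof.
intros [s [t [Hs [Ht Hp]]]] [s' [t' [Hs' [Ht' Hp']]]].
destruct (is_pair_inj Hp Hp') as [[<- <-] | [<- <-]].
- assert (E1 := is_pair_inj Hs Hs'); assert (E2 := is_pair_inj Ht Ht').
  intuition congruence.
- assert (E1 := is_pair_inj Hs Ht'); assert (E2 := is_pair_inj Ht Hs').
  intuition congruence.
Qed.

Lemma maps_mem f a b p : is_ordered_pair a b p -> maps f a b <-> p ∈ f.
Proof.
intro Hp; split.
- intros [q [Hq Hf]]; rewrite (ordered_pair_unique Hp Hq); exact Hf.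
- intro Hf; exists p; split; assumption.
Qed.

Lemma bijection_maps f A B a b :
  bijection f A B -> maps f a b -> a ∈ A /\ b ∈ B.
Proof.
intros [Hf _] [p [Hp Hpf]].
destruct (Hf p Hpf) as [a' [b' [Ha [Hb Hp']]]].
destruct (ordered_pair_inj Hp Hp') as [-> ->]; split; assumption.
Qed.

Lemma bijection_insert f A B A' B' a b :
  bijection f A B -> a ∉ A -> b ∉ B ->
  extension A' (fun x => x ∈ A \/ x = a) ->
  extension B' (fun x => x ∈ B \/ x = b) ->
  exists f', bijection f' A' B'.
Proof.
intros Hf Ha Hb HA' HB'.
destruct (ordered_pair_exists a b) as [p Hp].
destruct (insert_exists f p) as [f' Hf'].
(* From here on [f'], the set [f] with one pair added, is handled only through the relation
   [maps]. *)
assert (E : forall x y, maps f' x y <-> maps f x y \/ x = a /\ y = b).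
{ intros x y; destruct (ordered_pair_exists x y) as [q Hq].
  rewrite (maps_mem f' Hq), (maps_mem f Hq), (Hf' q).
  split; (intros [H | H]; [left; exact H | right]).
  - subst q; exact (ordered_pair_inj Hq Hp).
  - destruct H as [-> ->]; exact (ordered_pair_unique Hq Hp). }
assert (Hdom := fun x y => @bijection_maps f A B x y Hf).
destruct Hf as [Hf1 [Hf2 [Hf3 [Hf4 Hf5]]]].
exists f'; repeat split.
- intros q Hq; apply Hf' in Hq; destruct Hq as [Hq | ->].
  + destruct (Hf1 q Hq) as [x [y [Hx [Hy Hxy]]]].
    exists x, y; repeat split; [apply HA' | apply HB' |]; auto.
  + exists a, b; repeat split; [apply HA' | apply HB' |]; auto.
- intros x Hx; apply HA' in Hx; destruct Hx as [Hx | ->].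
  + destruct (Hf2 x Hx) as [y Hy]; exists y; apply E; auto.
  + exists b; apply E; auto.
- intros x y z Hy Hz; apply E in Hy, Hz.
  destruct Hy as [Hy | [-> ->]], Hz as [Hz | [Hz1 Hz2]].
  + exact (Hf3 x y z Hy Hz).
  + subst x; destruct (Ha (proj1 (Hdom _ _ Hy))).
  + destruct (Ha (proj1 (Hdom _ _ Hz))).
  + symmetry; exact Hz2.
- intros y Hy; apply HB' in Hy; destruct Hy as [Hy | ->].
  + destruct (Hf4 y Hy) as [x Hx]; exists x; apply E; auto.
  + exists a; apply E; auto.
- intros x y z Hx Hy; apply E in Hx, Hy.
  destruct Hx as [Hx | [-> ->]], Hy as [Hy | [Hy1 Hy2]].
  + exact (Hf5 x y z Hx Hy).
  + subst z; destruct (Hb (proj2 (Hdom _ _ Hx))).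
  + destruct (Hb (proj2 (Hdom _ _ Hy))).
  + symmetry; exact Hy1.
Qed.

(** Delete from [f] the pair of [a] and its image [b]. With [A'] the successor of [A] and [a = A],
    this is the descent step for induction on the size of a finite set. *)
Lemma bijection_remove f A A' B' a :
  bijection f A' B' -> a ∉ A ->
  extension A' (fun x => x ∈ A \/ x = a) ->
  exists b B f', b ∈ B' /\ extension B (fun x => x ∈ B' /\ x <> b) /\
    bijection f' A B.
Proof.
intros Hf Ha HA'.
assert (Hdom := fun x y => @bijection_maps f A' B' x y Hf).
destruct Hf as [Hf1 [Hf2 [Hf3 [Hf4 Hf5]]]].
destruct (Hf2 a) as [b Hab]; [apply HA'; auto |].
destruct (remove_exists B' b) as [B HB].
destruct (ordered_pair_exists a b) as [p Hp].
destruct (remove_exists f p) as [f' Hf'].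
assert (E : forall x y, maps f' x y <-> maps f x y /\ x <> a).
{ intros x y; destruct (ordered_pair_exists x y) as [q Hq].
  rewrite (maps_mem f' Hq), (Hf' q).
  split; intros [H N]; split; try (apply (maps_mem f Hq); exact H).
  - intros ->; apply N.
    assert (y = b) as ->
      by exact (Hf3 _ _ _ (proj2 (maps_mem f Hq) H) Hab).
    exact (ordered_pair_unique Hq Hp).
  - intros ->; apply N; exact (proj1 (ordered_pair_inj Hq Hp)). }
assert (HA : forall x, x ∈ A <-> x ∈ A' /\ x <> a).
{ intro x; rewrite (HA' x); split.
  - intro Hx; split; [auto |]; intros ->; exact (Ha Hx).
  - intros [[Hx | Hx] N]; [exact Hx | destruct (N Hx)]. }
assert (Hne : forall x y, maps f x y -> x <> a -> y <> b).
{ intros x y Hxy N ->; exact (N (Hf5 _ _ _ Hxy Hab)). }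
exists b, B, f'; split; [exact (proj2 (Hdom _ _ Hab)) |].
split; [exact HB |]; repeat split.
- intros q Hq; apply Hf' in Hq; destruct Hq as [Hq N].
  destruct (Hf1 q Hq) as [x [y [Hx [Hy Hxy]]]].
  assert (Hm : maps f' x y) by (apply (maps_mem f' Hxy), Hf'; auto).
  apply E in Hm; destruct Hm as [Hm Nx].
  exists x, y; repeat split; [apply HA; auto | apply HB | exact Hxy].
  split; [exact Hy | exact (Hne _ _ Hm Nx)].
- intros x Hx; apply HA in Hx; destruct Hx as [Hx N].
  destruct (Hf2 x Hx) as [y Hy]; exists y; apply E; auto.
- intros x y z Hy Hz; apply E in Hy, Hz.
  exact (Hf3 _ _ _ (proj1 Hy) (proj1 Hz)).
- intros y Hy; apply HB in Hy; destruct Hy as [Hy N].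
  destruct (Hf4 y Hy) as [x Hx]; exists x; apply E; split; [exact Hx |].
  intros ->; exact (N (Hf3 _ _ _ Hx Hab)).
- intros x y z Hx Hy; apply E in Hx, Hy.
  exact (Hf5 _ _ _ (proj1 Hx) (proj1 Hy)).
Qed.

(** * Induction on natural numbers and finite sets *)

(** Natural numbers lie in every inductive set, so it suffices that the members of some inductive
    set satisfying [P] form an inductive set; [P] must be definable for separation to provide that
    set. *)
Lemma natural_induction (P : (nat -> M) -> Prop) (rho : nat -> M) :
  definable P ->
  (forall e, extension e (fun _ => False) -> P (scons e rho)) ->
  (forall n s, P (scons n rho) -> is_successor n s -> P (scons s rho)) ->
  forall n, natural_number n -> P (scons n rho).
Proof.
intros HP H0 HS n Hn.
destruct (ZF_infinity HM) as [I [[e [He HeI]] HI]].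
destruct (@definable_separation P rho I HP) as [J HJ].
assert (HJi : inductive_set J).
{ split.
  - exists e; split; [exact He | apply HJ; auto].
  - intros m Hm; apply HJ in Hm; destruct Hm as [HmI Hm].
    destruct (HI m HmI) as [s [Hs HsI]].
    exists s; split; [exact Hs | apply HJ; split; [exact HsI |]].
    exact (HS m s Hm Hs). }
exact (proj2 (proj1 (HJ n) (Hn J HJi))).
Qed.

Lemma finite_empty e : extension e (fun _ => False) -> finite e.
Proof.
(* The empty set serves both as the number zero and as the bijection. *)
intro He; exists e, e; split.
- intros I [[e' [He' HI]] _]; rewrite (extension_unique He He'); exact HI.
- repeat split.
  + intros p Hp; destruct (proj1 (He p) Hp).
  + intros a Ha; destruct (proj1 (He a) Ha).
  + intros a b c [p [_ Hp]]; destruct (proj1 (He p) Hp).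
  + intros b Hb; destruct (proj1 (He b) Hb).
  + intros a b c [p [_ Hp]]; destruct (proj1 (He p) Hp).
Qed.

Lemma finite_insert A B a :
  finite A -> extension B (fun x => x ∈ A \/ x = a) -> finite B.
Proof.
intros HA HB; destruct (classic (a ∈ A)) as [Ha | Ha].
- assert (B = A) as ->; [| exact HA].
  apply (ZF_extensionality HM); intro x; rewrite (HB x).
  split; [intros [H | ->]; assumption | auto].
- destruct HA as [n [f [Hn Hf]]].
  destruct (insert_exists n n) as [s Hs].
  destruct (bijection_insert Hf (@mem_irrefl n) Ha Hs HB) as [f' Hf'].
  exists s, f'; split; [| exact Hf'].
  intros I HI; destruct (proj2 HI n (Hn I HI)) as [s' [Hs' HsI]].
  rewrite (extension_unique Hs Hs'); exact HsI.
Qed.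

(** The induction hypothesis is a set [S], not a class, so that the induction
    formula is definable without renaming variables in another formula. *)
Lemma finite_induction (S Y : M) :
  (forall e, extension e (fun _ => False) -> e ∈ S) ->
  (forall D D' u, D ∈ S -> D ⊆ Y -> u ∈ Y ->
     extension D' (fun x => x ∈ D \/ x = u) -> D' ∈ S) ->
  forall D, finite D -> D ⊆ Y -> D ∈ S.
Proof.
intros H0 HS D [n [f [Hn Hf]]] HD.
assert (H : forall D f, bijection f n D -> D ⊆ Y -> D ∈ S);
  [| exact (H D f Hf HD)].
refine (@natural_induction
  (fun rho => forall D f, bijection f (rho 0) D -> D ⊆ rho 1 -> D ∈ rho 2)
  (scons Y (fun _ => S)) _ _ _ n Hn); [definability | |]; simpl.
- clear -HM H0; intros e He D f Hf _; apply H0; intro x; split.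
  + intro Hx; destruct (proj1 (proj2 (proj2 (proj2 Hf))) x Hx) as [a Ha].
    exact (proj1 (He a) (proj1 (bijection_maps Hf Ha))).
  + contradiction.
- clear -HM HS; intros n s IH Hs D f Hf HD.
  destruct (bijection_remove Hf (@mem_irrefl n) Hs)
    as [b [B [f' [Hb [HB Hf']]]]].
  assert (HBY : B ⊆ Y) by (intros x Hx; apply HD; apply HB in Hx; apply Hx).
  apply (HS B D b (IH B f' Hf' HBY) HBY (HD b Hb)).
  intro x; rewrite (HB x); split.
  + intro Hx; destruct (classic (x = b)); auto.
  + intros [[Hx _] | ->]; assumption.
Qed.

Lemma finite_subset A B : finite A -> B ⊆ A -> finite B.
Proof.
intros HA; destruct (ZF_powerset HM A) as [PA HPA].
(* The induction set asks that all subsets be finite: removing [u] from a subset of [D'] gives an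
   arbitrary subset of [D], not [D] itself. *)
destruct (@definable_separation
  (fun rho => forall E, E ⊆ rho 0 -> finite E) (fun _ => A) PA) as [S HS];
  [definability | simpl in HS].
assert (H : A ∈ S); [| intro HB; apply HS in H; exact (proj2 H B HB)].
apply (@finite_induction S A); [| | exact HA | auto].
- intros e He; apply HS; split.
  + apply HPA; intros x Hx; apply He in Hx; contradiction.
  + intros E HE; apply finite_empty; intro x; split; [| contradiction].
    intro Hx; exact (proj1 (He x) (HE x Hx)).
- intros D D' u HD HDA Hu HD'; apply HS; split.
  + apply HPA; intros x Hx; apply HD' in Hx; destruct Hx as [Hx | ->]; auto.
  + apply HS in HD; destruct HD as [_ HD]; intros E HE.
    destruct (remove_exists E u) as [F HF].
    assert (HFfin : finite F).
    { apply HD; intros x Hx; apply HF in Hx; destruct Hx as [Hx N].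
      apply HE, HD' in Hx; destruct Hx; [assumption | contradiction]. }
    destruct (classic (u ∈ E)) as [HuE | HuE].
    * apply (finite_insert (a := u) HFfin); intro x; rewrite (HF x); split.
      -- intro Hx; destruct (classic (x = u)); auto.
      -- intros [[Hx _] | ->]; assumption.
    * assert (E = F) as ->; [| exact HFfin].
      apply (ZF_extensionality HM); intro x; rewrite (HF x); split.
      -- intro Hx; split; [exact Hx |]; intros ->; exact (HuE Hx).
      -- intros [Hx _]; exact Hx.
Qed.

End SetTheory.

(** * Neighbourhoods, closed sets and compact sets *)

Section Topology.
Context {M : set_structure} (HM : ZF_model M) (X tau : M).
Implicit Types (A B C D K L U V W e x y : M).

Lemma topology_inter U V :
  topology X tau -> U ∈ tau -> V ∈ tau ->
  exists W, W ∈ tau /\ extension W (fun x => x ∈ U /\ x ∈ V).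
Proof.
intros [_ [_ [_ [_ H]]]] HU HV.
destruct (H U V HU HV) as [W [HW HWt]]; exists W; auto.
Qed.

(** The complement of [B] is the union of all open sets disjoint from [B]; taking all of them avoids
    choosing a neighbourhood for each point. *)
Lemma closed_of_neighborhoods B :
  topology X tau -> B ⊆ X ->
  (forall x, x ∈ X -> x ∉ B ->
     exists V, V ∈ tau /\ x ∈ V /\ forall z, z ∈ V -> z ∉ B) ->
  closed X tau (fun x => x ∈ B).
Proof.
intros [Hsub [_ [_ [HU _]]]] HB Hnb; split; [exact HB |].
destruct (@definable_separation M HM
  (fun rho => forall z, z ∈ rho 0 -> z ∉ rho 1) (fun _ => B) tau)
  as [C HC]; [definability | simpl in HC].
destruct (HU C) as [N [HN HNt]].
{ intros U HUC; apply HC in HUC; apply HUC. }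
exists N; split; [| exact HNt]; intro x; rewrite (HN x); split.
- intros [U [HUC Hx]]; apply HC in HUC; destruct HUC as [HUt HUB].
  split; [exact (Hsub U HUt x Hx) | exact (HUB x Hx)].
- intros [Hx HxB]; destruct (Hnb x Hx HxB) as [V [HVt [HxV HV]]].
  exists V; split; [apply HC; auto | exact HxV].
Qed.

(** Neighbourhoods are intersected one at a time along finite induction, and the induction set
    records only that a common one exists. Disjointness is required inside [B] only, since a
    complement of a compact set may well meet [V] outside [B]. *)
Lemma finite_common_neighborhood B x D :
  topology X tau -> x ∈ X -> finite D ->
  (forall U, U ∈ D -> exists V, V ∈ tau /\ x ∈ V /\
     forall z, z ∈ V -> z ∈ B -> z ∉ U) ->
  exists V, V ∈ tau /\ x ∈ V /\
    forall U z, U ∈ D -> z ∈ V -> z ∈ B -> z ∉ U.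
Proof.
intros Ht Hx HD Hloc; destruct (ZF_powerset HM D) as [PD HPD].
destruct (@definable_separation M HM
  (fun rho => exists V, V ∈ rho 1 /\ rho 2 ∈ V /\
     forall U z, U ∈ rho 0 -> z ∈ V -> z ∈ rho 3 -> z ∉ U)
  (scons tau (scons x (fun _ => B))) PD) as [S HS];
  [definability | simpl in HS].
assert (H : D ∈ S); [| apply HS in H; exact (proj2 H)].
apply (@finite_induction M HM S D); [| | exact HD | auto].
- intros e He; apply HS; split.
  + apply HPD; intros z Hz; apply He in Hz; contradiction.
  + exists X; split; [apply Ht | split; [exact Hx |]].
    intros U z HU; apply He in HU; contradiction.
- intros E E' u HE HED Hu HE'; apply HS; split.
  + apply HPD; intros z Hz; apply HE' in Hz; destruct Hz as [Hz | ->]; auto.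
  + apply HS in HE; destruct HE as [_ [V [HVt [HxV HV]]]].
    destruct (Hloc u Hu) as [V' [HVt' [HxV' HV']]].
    destruct (topology_inter Ht HVt HVt') as [W [HWt HW]].
    exists W; split; [exact HWt | split; [apply HW; auto |]].
    intros U z HU Hz HzB; apply HW in Hz; destruct Hz as [Hz Hz'].
    apply HE' in HU; destruct HU as [HU | ->].
    * exact (HV U z HU Hz HzB).
    * exact (HV' z Hz' HzB).
Qed.

Lemma compact_closed K :
  hausdorff_space X tau -> compact X tau K ->
  closed X tau (fun x => x ∈ K).
Proof.
intros [Ht Hsep] [HKX HK]; apply closed_of_neighborhoods; auto.
intros x Hx HxK.
(* [C] consists of all open sets that some neighbourhood of [x] avoids inside [K]; the Hausdorff
   property makes it cover [K]. *)
destruct (@definable_separation M HM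
  (fun rho => exists V, V ∈ rho 1 /\ rho 2 ∈ V /\
     forall z, z ∈ V -> z ∈ rho 3 -> z ∉ rho 0)
  (scons tau (scons x (fun _ => K))) tau) as [C HC];
  [definability | simpl in HC].
destruct (HK C) as [D [HDC [HD Hcov]]].
- intros U HU; apply HC in HU; apply HU.
- intros y Hy; destruct (Hsep x y Hx (HKX y Hy)) as
    [V [W [HV [HW [HxV [HyW Hdis]]]]]]; [intros ->; exact (HxK Hy) |].
  exists W; split; [| exact HyW]; apply HC; split; [exact HW |].
  exists V; repeat split; auto; intros z Hz _ HzW; exact (Hdis z (conj Hz HzW)).
- destruct (@finite_common_neighborhood K x D Ht Hx HD) as
    [V [HVt [HxV HV]]].
  { intros U HU; apply HDC, HC in HU; apply HU. }
  exists V; repeat split; auto; intros z HzV HzK.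
  destruct (Hcov z HzK) as [U [HU HzU]]; exact (HV U z HU HzV HzK HzU).
Qed.

(** Adding [W] to a cover of [L] gives a cover of [K]; removing [W] from a finite subcover leaves
    one of [L]. *)
Lemma compact_difference_open K W L :
  compact X tau K -> W ∈ tau ->
  extension L (fun x => x ∈ K /\ x ∉ W) -> compact X tau L.
Proof.
intros [HKX HK] HW HL; split.
{ intros x Hx; apply HL in Hx; apply HKX, Hx. }
intros C HC Hcov; destruct (insert_exists HM C W) as [C' HC'].
destruct (HK C') as [D [HDC [HD HDcov]]].
- intros U HU; apply HC' in HU; destruct HU as [HU | ->]; auto.
- intros x Hx; destruct (classic (x ∈ W)) as [HxW | HxW].
  + exists W; split; [apply HC'; auto | exact HxW].
  + destruct (Hcov x) as [U [HU HxU]]; [apply HL; auto |].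
    exists U; split; [apply HC'; auto | exact HxU].
- destruct (remove_exists HM D W) as [E HE].
  exists E; repeat split.
  + intros U HU; apply HE in HU; destruct HU as [HU N].
    apply HDC, HC' in HU; destruct HU; [assumption | contradiction].
  + apply (finite_subset HM HD); intros U HU; apply HE in HU; apply HU.
  + intros x Hx; apply HL in Hx; destruct Hx as [HxK HxW].
    destruct (HDcov x HxK) as [U [HU HxU]].
    exists U; split; [apply HE; split; [exact HU |] | exact HxU].
    intros ->; exact (HxW HxU).
Qed.

(** Passes between an intersection given as a class, as in [k_space], and the set that realizes
    it. *)
Lemma closed_class_set A (P : M -> Prop) :
  extension A P -> closed X tau P <-> closed X tau (fun x => x ∈ A).
Proof.
intro HA; split; intros [H [s [Hs Hst]]]; split.
- intros x Hx; apply H, HA, Hx.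
- exists s; split; [| exact Hst]; intro x; rewrite (Hs x), (HA x); reflexivity.
- intros x Hx; apply H, HA, Hx.
- exists s; split; [| exact Hst]; intro x; rewrite (Hs x), (HA x); reflexivity.
Qed.

(** The intersection is [K] minus the open complement [W] of [A]. *)
Lemma compact_inter_closed A K L :
  compact X tau K -> closed X tau (fun x => x ∈ A) ->
  extension L (fun x => x ∈ A /\ x ∈ K) -> compact X tau L.
Proof.
intros HK [_ [W [HW HWt]]] HL.
apply (compact_difference_open HK HWt); intro x; rewrite (HL x); split.
- intros [HxA HxK]; split; [exact HxK |].
  intro HxW; apply HW in HxW; exact (proj2 HxW HxA).
- intros [HxK HxW]; split; [apply NNPP; intro HxA | exact HxK].
  apply HxW, HW; split; [exact (proj1 HK x HxK) | exact HxA].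
Qed.

(** Compact sets are closed in a Hausdorff space, so their complements are open. *)
Lemma compact_complement_topology_coarser tau_star :
  hausdorff_space X tau -> compact_complement_topology X tau tau_star ->
  tau_star ⊆ tau.
Proof.
intros HX Hstar U HU; apply Hstar in HU.
destruct HU as [HU | [K [HK HU]]].
- destruct HX as [[_ [[e [He Het]] _]] _].
  rewrite (extension_unique HM HU He); exact Het.
- destruct (compact_closed HX HK) as [_ [V [HV HVt]]].
  rewrite (extension_unique HM HU HV); exact HVt.
Qed.

End Topology.

(** * k-spaces and the compact sets of the compact complement topology *)

Unset Implicit Arguments.
Set Strict Implicit.

Theorem theorem3p1 (M : set_structure) (HM : ZF_model M)
  (X tau tau_star : M)
  (HX : hausdorff_space X tau) (Xinf : infinite X)
  (Hstar : compact_complement_topology X tau tau_star) :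
  k_space X tau <->
  (forall A : M, compact X tau_star A -> closed X tau (fun x => x ∈ A)).
Proof.
split.
- intros [_ Hk] A [HAX HA]; apply (Hk A HAX); intros K HK.
  destruct (intersection_exists HM A K) as [L HL].
  apply (closed_class_set X tau HL), (closed_of_neighborhoods HM (proj1 HX)).
  { intros x Hx; apply HL in Hx; apply HAX, Hx. }
  (* If [x ∈ A], then [x ∉ K], and the open complement of [K] is the neighbourhood sought. The
     covering argument handles [x ∉ A]. *)
  intros x Hx HxL; destruct (classic (x ∈ A)) as [HxA | HxA].
  { destruct (compact_closed HM HX HK) as [_ [V [HV HVt]]].
    exists V; split; [exact HVt |]; split.
    - apply HV; split; [exact Hx |]; intro HxK; apply HxL, HL; auto.
    - intros z Hz HzL; apply HV in Hz; apply HL in HzL.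
      exact (proj2 Hz (proj2 HzL)). }
  (* The cover of [A] consists of all [tau_star]-open sets that some [tau]-neighbourhood of [x]
     avoids inside [K]. *)
  destruct (@definable_separation M HM
    (fun rho => exists V, V ∈ rho 1 /\ rho 2 ∈ V /\
       forall z, z ∈ V -> z ∈ rho 3 -> z ∉ rho 0)
    (scons tau (scons x (fun _ => K))) tau_star) as [C HC];
    [definability | simpl in HC].
  destruct (HA C) as [D [HDC [HD Hcov]]].
  + intros U HU; apply HC in HU; apply HU.
  + intros y Hy; destruct (proj2 HX x y Hx (HAX y Hy)) as
      [V [W [HV [HW [HxV [HyW Hdis]]]]]]; [intros ->; exact (HxA Hy) |].
    (* With [J] the compact set [K] minus [W], the complement [U] of [J] is [tau_star]-open and
       contains [y]. Inside [K] it reduces to [W], which is disjoint from [V]. *)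
    destruct (difference_exists HM K W) as [J HJ].
    destruct (difference_exists HM X J) as [U HU].
    exists U; split.
    * apply HC; split.
      -- apply Hstar; right; exists J; split; [| exact HU].
         exact (compact_difference_open HM HK HW HJ).
      -- exists V; repeat split; auto; intros z HzV HzK HzU.
         apply HU in HzU; destruct HzU as [_ HzJ]; apply HzJ, HJ.
         split; [exact HzK |]; intro HzW; exact (Hdis z (conj HzV HzW)).
    * apply HU; split; [exact (HAX y Hy) |].
      intro HyJ; apply HJ in HyJ; exact (proj2 HyJ HyW).
  + destruct (finite_common_neighborhood HM (B := K) (proj1 HX) Hx HD)
      as [V [HVt [HxV HV]]].
    { intros U HU; apply HDC, HC in HU; apply HU. }
    exists V; repeat split; auto; intros z HzV HzL.
    apply HL in HzL; destruct HzL as [HzA HzK].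
    destruct (Hcov z HzA) as [U [HU HzU]]; exact (HV U z HU HzV HzK HzU).
- intro Hcl; split; [exact HX |]; intros A HAX; split.
  + intros HA K HK; destruct (intersection_exists HM A K) as [L HL].
    apply (closed_class_set X tau HL), (compact_closed HM HX).
    exact (compact_inter_closed HM HK HA HL).
  + intro HA; apply Hcl; split; [exact HAX |]; intros C HC Hcov.
    (* An empty [A] offers no point from which to pick a nonempty member of the cover; the empty
       subfamily then covers it. *)
    destruct (classic (exists x, x ∈ A)) as [[x Hx] | Hempty].
    2:{ destruct (empty_exists HM) as [e He].
        exists e; repeat split.
        - intros U HU; apply He in HU; contradiction.
        - exact (finite_empty HM He).
        - intros y Hy; destruct Hempty; exists y; exact Hy. }
    destruct (Hcov x Hx) as [U [HUC HxU]].
    (* Since [U] contains [x], it is not empty and so is the complement of a compact [K]. *)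
    destruct (proj1 (Hstar U) (HC U HUC)) as [HU | [K [HK HU]]];
      [destruct (proj1 (HU x) HxU) |].
    destruct (intersection_exists HM A K) as [L HL].
    assert (HLc : compact X tau L).
    (* Only [L], the intersection of [A] and [K], is known to be closed, so [L] takes the role of
       the closed set and is intersected with [K] again. *)
    { apply (@compact_inter_closed M HM X tau L K L HK).
      - apply (closed_class_set X tau HL), (HA K HK).
      - intro y; split; [| intros [Hy _]; exact Hy].
        intro Hy; split; [exact Hy |]; apply HL in Hy; apply Hy. }
    destruct (proj2 HLc C) as [D [HDC [HD HDcov]]].
    { intros W HW.
      exact (compact_complement_topology_coarser HM HX Hstar (HC W HW)). }
    { intros y Hy; apply HL in Hy; apply Hcov, Hy. }
    (* [D] covers the points of [A] in [K], and [U] covers all the others. *)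
    destruct (insert_exists HM D U) as [E HE].
    exists E; repeat split.
    * intros W HW; apply HE in HW; destruct HW as [HW | ->]; auto.
    * exact (finite_insert HM HD HE).
    * intros y Hy; destruct (classic (y ∈ K)) as [HyK | HyK].
      -- destruct (HDcov y) as [W [HW HyW]]; [apply HL; auto |].
         exists W; split; [apply HE; auto | exact HyW].
      -- exists U; split; [apply HE; auto | apply HU; auto].
Qed.
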